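(* For every $d\in\mathbb{D}$, $\mathsf{eltof}(\mathsf{typof}(d))=d$, and for every type $A$, $\mathsf{typof}(\mathsf{eltof}(A))\approx A$.
   Context: **Domain.** $\mathbb{D}$ is inductively defined by $\mathbb{D}=\mathbb{Z}+\mathcal{P}_f(\mathbb{D}\times\mathbb{D})$ ($\mathcal{P}_f$ = finite subsets); $t$ ranges over finite subsets of $\mathbb{D}\times\mathbb{D}$ (''tables''). **Types.** Function types $F,G,H ::= A\to B\mid F\wedge G\mid\top$; types $A,B,C ::= n\mid F$ (with $n\in\mathbb{Z}$ a singleton type). **Subtyping** $<:$ is the least relation with: $A<:A$; $A<:B,\ B<:C\Rightarrow A<:C$; $A\approx A',\ B\approx B'\Rightarrow A\to B<:A'\to B'$; $H<:F,\ H<:G\Rightarrow H<:F\wedge G$; $F\wedge G<:F$; $F\wedge G<:G$; $A\to B<:\top$. Here $A\approx B$ means $A<:B$ and $B<:A$. **Translations.** $\mathsf{typof}:\mathbb{D}\to$ types: $\mathsf{typof}(n)=n$, $\mathsf{typof}(t)=\bigwedge_{(d,d')\in t}(\mathsf{typof}(d)\to\mathsf{typof}(d'))$, the finite conjunction being taken along some fixed enumeration of $t$ and ending in $\top$ (so $\mathsf{typof}(\emptyset)=\top$); the choice of enumeration is immaterial up to $\approx$. $\mathsf{eltof}$: types $\to\mathbb{D}$: $\mathsf{eltof}(n)=n$, $\mathsf{eltof}(A\to B)=\{(\mathsf{eltof}(A),\mathsf{eltof}(B))\}$, $\mathsf{eltof}(F\wedge G)=\mathsf{eltof}(F)\cup\mathsf{eltof}(G)$,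 $\mathsf{eltof}(\top)=\emptyset$. *)

(* Defs.v *)
From HB Require Import structures.
From mathcomp Require Import all_boot ssrint finmap.

Set Implicit Arguments.
Unset Strict Implicit.
Unset Printing Implicit Defensive.

Local Open Scope fset_scope.

(* The equation D = Z + P_f(D * D) is not strictly positive when P_f is        *)
(* rendered by {fset _}. D is therefore carved out of finitely branching trees *)
(* as the subtype of those trees in which every list of rows is the canonical  *)
(* duplicate-free listing of a finite set. Trees are only an encoding: dint    *)
(* and dtab below are injective with disjoint ranges, and generate the whole   *)
(* of domain by domain_ind.                                                    *)

Inductive tree := Leaf of int | Node of seq (tree * tree).

Fixpoint tree_encode (x : tree) : GenTree.tree int :=
  match x with
  | Leaf n => GenTree.Leaf n
  | Node s => GenTree.Node 0
      [seq (let: (a, b) := p in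
            GenTree.Node 0 [:: tree_encode a; tree_encode b]) | p <- s]
  end.

Fixpoint tree_decode (g : GenTree.tree int) : tree :=
  match g with
  | GenTree.Leaf n => Leaf n
  | GenTree.Node _ s => Node
      [seq (match h with
            | GenTree.Node _ [:: a; b] => (tree_decode a, tree_decode b)
            | _ => (Leaf 0, Leaf 0)
            end) | h <- s]
  end.

Definition tree_nested_ind (P : tree -> Prop)
    (P_leaf : forall n, P (Leaf n))
    (P_node : forall s,
       foldr (fun p Q => (P p.1 /\ P p.2) /\ Q) True s -> P (Node s)) :
    forall x, P x :=
  fix ind x := match x with
  | Leaf n => P_leaf n
  | Node s => P_node s
      ((fix rows_ind (s : seq (tree * tree)) :
          foldr (fun p Q => (P p.1 /\ P p.2) /\ Q) True s :=
          match s with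
          | [::] => I
          | (a, b) :: s' => conj (conj (ind a) (ind b)) (rows_ind s')
          end) s)
  end.

Lemma tree_encodeK : cancel tree_encode tree_decode.
Proof.
elim/tree_nested_ind=> [n|s IHs] //=; congr Node; rewrite -map_comp.
elim: s IHs => [|[a b] s IHs] //= [[IHa IHb] /IHs ->].
by rewrite IHa IHb.
Qed.

HB.instance Definition _ := Countable.copy tree (can_type tree_encodeK).

Fixpoint canonical (x : tree) : bool :=
  match x with
  | Leaf _ => true
  | Node s => canonical_keys s &&
      all (fun p => let: (a, b) := p in canonical a && canonical b) s
  end.

Record domain := Domain { tree_of : tree; tree_ofP : canonical tree_of }.

HB.instance Definition _ := [isSub for tree_of].
HB.instance Definition _ := [Countable of domain by <:].

Notation table := {fset (domain * domain)}.

Definition tree_row (p : domain * domain) : tree * tree :=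
  (tree_of p.1, tree_of p.2).

Definition rows (t : table) : seq (tree * tree) :=
  sort_keys [seq tree_row p | p <- enum_fset t].

Lemma canonical_rows (t : table) : canonical (Node (rows t)).
Proof.
rewrite /= canonical_sort_keys; apply/allP=> p.
by rewrite sort_keysE => /mapP[[d d'] _ ->]; rewrite /= !tree_ofP.
Qed.

Definition dint (n : int) : domain := @Domain (Leaf n) isT.
Definition dtab (t : table) : domain := Domain (canonical_rows t).

Definition untree_row (p : tree * tree) : domain * domain :=
  (insubd (dint 0) p.1, insubd (dint 0) p.2).

Definition enum_table (t : table) : seq (domain * domain) :=
  [seq untree_row p | p <- rows t].

Lemma tree_row_inj : injective tree_row.
Proof. by case=> [a b] [c d] [/val_inj -> /val_inj ->]. Qed.

Lemma tree_rowK : cancel tree_row untree_row.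
Proof. by case=> [a b]; rewrite /untree_row /tree_row /= !valKd. Qed.

Lemma untree_rowK (a b : tree) :
  canonical a -> canonical b -> tree_row (untree_row (a, b)) = (a, b).
Proof.
by move=> aP bP; congr pair; apply: (insubdK (dint 0)).
Qed.

Lemma perm_enum_table (t : table) : perm_eq (enum_table t) (enum_fset t).
Proof.
rewrite -[X in perm_eq _ X](mapK tree_rowK); apply: perm_map.
rewrite (perm_trans (sort_keys_perm _)) // undup_id //.
by rewrite (map_inj_uniq tree_row_inj) fset_uniq.
Qed.

Lemma dint_inj : injective dint.
Proof. by move=> m n []. Qed.

Lemma dtab_inj : injective dtab.
Proof.
move=> t u [/eq_sort_keys eq_tu]; apply/fsetP=> p.
by have := eq_tu (tree_row p); rewrite !(mem_map tree_row_inj).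
Qed.

Lemma dint_neq_dtab (n : int) (t : table) : dint n <> dtab t.
Proof. by []. Qed.

Lemma domain_ind (P : domain -> Prop) :
  (forall n, P (dint n)) ->
  (forall t : table, (forall d d', (d, d') \in t -> P d /\ P d') -> P (dtab t)) ->
  forall d, P d.
Proof.
move=> Pint Ptab [x xP].
elim/tree_nested_ind: x xP => [n|s IHs] xP.
  by rewrite (_ : Domain xP = dint n) //; apply: val_inj.
pose t : table := seq_fset tt [seq untree_row p | p <- s].
have /andP[/eqP s_can /allP s_all] := xP.
have rowK p : p \in s -> tree_row (untree_row p) = p.
  by case: p => a b /s_all /andP[]; apply: untree_rowK.
have Dt : Domain xP = dtab t.
  apply: val_inj => /=; congr Node; rewrite -[LHS]s_can.
  apply/eq_sort_keys => p; apply/idP/mapP=> [sp|[q]].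
    by exists (untree_row p); rewrite ?rowK // seq_fsetE map_f.
  by rewrite seq_fsetE => /mapP[r sr ->] ->; rewrite rowK.
rewrite Dt; apply: Ptab => d d'; rewrite seq_fsetE => /mapP[[a b] sp [-> ->]].
have /andP[aP bP] := s_all _ sp.
elim: s IHs sp {xP t s_can s_all rowK Dt} => [|[a' b'] s IH] //=.
move=> [[IHa IHb] IHs]; rewrite inE => /predU1P[[Da Db]|]; last exact: IH.
rewrite -Da in IHa; rewrite -Db in IHb.
by rewrite /insubd !insubT; split; [apply: IHa | apply: IHb].
Qed.

Inductive funty :=
  | Arr of ty & ty
  | And of funty & funty
  | Top
with ty :=
  | Sing of int
  | Fun of funty.

Coercion Fun : funty >-> ty.

Inductive subty : ty -> ty -> Prop :=
  | sub_refl (A : ty) : subty A A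
  | sub_trans (A B C : ty) : subty A B -> subty B C -> subty A C
  | sub_arr (A A' B B' : ty) :
      subty A A' -> subty A' A -> subty B B' -> subty B' B ->
      subty (Arr A B) (Arr A' B')
  | sub_glb (F G H : funty) : subty H F -> subty H G -> subty H (And F G)
  | sub_andl (F G : funty) : subty (And F G) F
  | sub_andr (F G : funty) : subty (And F G) G
  | sub_top (A B : ty) : subty (Arr A B) Top.

Definition eqty (A B : ty) : Prop := subty A B /\ subty B A.

Definition bigAnd (s : seq funty) : funty := foldr And Top s.

(* A table is enumerated in the order of the rows of its tree, which is the    *)
(* order of enum_table.                                                        *)
Fixpoint typof_tree (x : tree) : ty :=
  match x with
  | Leaf n => Sing n
  | Node s => bigAnd
      [seq (let: (a, b) := p in Arr (typof_tree a) (typof_tree b)) | p <- s]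
  end.

Definition typof (d : domain) : ty := typof_tree (tree_of d).

Lemma typof_dint (n : int) : typof (dint n) = Sing n.
Proof. by []. Qed.

Lemma typof_dtab (t : table) :
  typof (dtab t) =
    bigAnd [seq Arr (typof p.1) (typof p.2) | p <- enum_table t].
Proof.
rewrite /typof /= /enum_table -map_comp; congr (Fun (bigAnd _)).
apply/eq_in_map=> p; rewrite sort_keysE => /mapP[q _ ->] /=.
by rewrite !valKd.
Qed.

Fixpoint eltof (A : ty) : domain :=
  match A with
  | Sing n => dint n
  | Fun F => dtab (eltof_fun F)
  end
with eltof_fun (F : funty) : table :=
  match F with
  | Arr A B => [fset (eltof A, eltof B)]
  | And F G => eltof_fun F `|` eltof_fun G
  | Top => fset0
  end.

(* Main.v *)
(* The type of a table is the greatest lower bound of the arrows of its rows,  *)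
(* whatever their enumeration. Hence typof sends unions to conjunctions up to  *)
(* eqty, and typof (eltof A) is compared with A by mutual induction on types.  *)

Require Import Defs.
From mathcomp Require Import all_boot ssrint finmap.

Local Open Scope fset_scope.

(* [eltof] turns the conjunction [typof (dtab t)] into a union of singletons, one per row, which is
   [t] again by induction on the rows ([typofK]). Conversely, [typof_row] and [typof_glb] replace
   enumerations by a universal property, which matches arrow, conjunction and top with singleton,
   union and empty set ([eltofK]). *)
Scheme ty_mut_ind := Induction for ty Sort Prop
with funty_mut_ind := Induction for funty Sort Prop.

Lemma in_eltof_bigAnd (T : eqType) (f : T -> funty) (s : seq T)
    (p : domain * domain) :
  (p \in eltof_fun (bigAnd [seq f x | x <- s])) =
  has (fun x => p \in eltof_fun (f x)) s.
Proof. by elim: s => [|x s IHs]; rewrite /= ?in_fset0 // in_fsetU IHs. Qed.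

(** The rule [sub_top] covers arrows only; a conjunction gets there through its left conjunct. *)
Lemma subty_Top (F : funty) : subty F Top.
Proof.
elim: F => [A B|F IHF G _|]; [exact: sub_top | | exact: Defs.sub_refl].
exact: sub_trans (sub_andl F G) IHF.
Qed.

Lemma subty_bigAnd (T : eqType) (f : T -> funty) (s : seq T) (x : T) :
  x \in s -> subty (bigAnd [seq f y | y <- s]) (f x).
Proof.
elim: s => [|y s IHs] //=; rewrite inE => /predU1P[->|/IHs sub_s].
  exact: sub_andl.
exact: sub_trans (sub_andr _ _) sub_s.
Qed.

Lemma bigAnd_glb (T : eqType) (f : T -> funty) (s : seq T) (H : funty) :
  (forall x, x \in s -> subty H (f x)) -> subty H (bigAnd [seq f x | x <- s]).
Proof.
elim: s => [|x s IHs] /= subH; first exact: subty_Top.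
apply: sub_glb; first by apply: subH; rewrite mem_head.
by apply: IHs => y sy; apply: subH; rewrite inE sy orbT.
Qed.

Lemma mem_enum_table (t : table) : enum_table t =i t.
Proof. exact: perm_mem (perm_enum_table t). Qed.

Lemma typof_row (t : table) (p : domain * domain) :
  p \in t -> subty (typof (dtab t)) (Arr (typof p.1) (typof p.2)).
Proof.
rewrite typof_dtab -mem_enum_table.
exact: (@subty_bigAnd _ (fun q => Arr (typof q.1) (typof q.2))).
Qed.

Lemma typof_glb (t : table) (H : funty) :
  (forall p, p \in t -> subty H (Arr (typof p.1) (typof p.2))) ->
  subty H (typof (dtab t)).
Proof.
move=> subH; rewrite typof_dtab; apply: bigAnd_glb => p.
by rewrite mem_enum_table; apply: subH.
Qed.

Lemma typof_subset (t u : table) :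
  u `<=` t -> subty (typof (dtab t)) (typof (dtab u)).
Proof.
(* Unfolding [typof] exposes the [funty] that [typof_glb] expects as lower bound. *)
move=> /fsubsetP sub_ut; rewrite [typof (dtab t)]typof_dtab.
apply: typof_glb => p /sub_ut tp; rewrite -typof_dtab; exact: typof_row.
Qed.

Lemma typofK : cancel typof eltof.
Proof.
elim/domain_ind=> [n|t IHt] //; rewrite typof_dtab /=; congr dtab.
apply/fsetP=> p; rewrite in_eltof_bigAnd -mem_enum_table -has_pred1.
(* By induction the arrow of the row [(d, d')] reads back as the singleton of that row. *)
apply: eq_in_has => -[d d']; rewrite mem_enum_table => /IHt[/= -> ->].
by rewrite in_fset1 eq_sym.
Qed.

Lemma eltofK (A : ty) : eqty (typof (eltof A)) A.
Proof.
apply: (ty_mut_ind (fun A => eqty (typof (eltof A)) A)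
                   (fun F => eqty (typof (eltof F)) F)) A
  => [n|F //|A [sAe sAl] B [sBe sBl]|F [sFe sFl] G [sGe sGl]|].
- by split; apply: Defs.sub_refl.
(* [sub_arr] is invariant in both arguments, so each half of the equivalence uses both halves of
   both induction hypotheses. *)
- split.
    apply: sub_trans (typof_row _ (eltof A, eltof B) _) _.
      by rewrite in_fset1.
    exact: sub_arr.
  apply: typof_glb => p; rewrite in_fset1 => /eqP-> /=; exact: sub_arr.
- split.
    rewrite /= typof_dtab; apply: sub_glb; rewrite -typof_dtab.
      exact: sub_trans (typof_subset _ _ (fsubsetUl _ _)) sFe.
    exact: sub_trans (typof_subset _ _ (fsubsetUr _ _)) sGe.
  apply: typof_glb => p; rewrite in_fsetU => /orP[Fp|Gp].
    apply: sub_trans (sub_andl F G) _.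
    exact: sub_trans sFl (typof_row _ _ Fp).
  apply: sub_trans (sub_andr F G) _.
  exact: sub_trans sGl (typof_row _ _ Gp).
- split; first by rewrite /= typof_dtab; apply: subty_Top.
  by apply: typof_glb.
Qed.

Theorem proposition4 :
  (forall d : domain, eltof (typof d) = d) /\
  (forall A : ty, eqty (typof (eltof A)) A).
Proof. by split; [apply: typofK | apply: eltofK]. Qed.
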